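(* Let $G$ be a free product of countably many groups, each of which is finite or isomorphic to $\mathbb{Z}$, and let $A$ be a finite abelian group. Then for every alphabet $\Sigma$, the restricted wreath product $A\wr G$ embeds as a subgroup of $\llbracket\Sigma^{\mathbb{Z}}\rrbracket$. In particular the lamplighter group $\mathbb{Z}_2\wr\mathbb{Z}$ embeds in $\llbracket\Sigma^{\mathbb{Z}}\rrbracket$.
   Context: An alphabet is a finite set with at least two elements. $\llbracket\Sigma^{\mathbb{Z}}\rrbracket$ is the group of homeomorphisms $f$ of $\Sigma^{\mathbb{Z}}$ with a continuous $c:\Sigma^{\mathbb{Z}}\to\mathbb{Z}$ such that $f(x)=\sigma^{c(x)}(x)$, where $\sigma(x)_i=x_{i+1}$. $A\wr G=\left(\bigoplus_G A\right)\rtimes G$ with $G$ acting by translation of coordinates. *)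

(* Defs.v *)
From HB Require Import structures.
From mathcomp Require Import all_boot all_order all_algebra.
From Stdlib Require Import List.
Set Implicit Arguments. Unset Strict Implicit. Unset Printing Implicit Defensive.
Import Order.TTheory GRing.Theory Num.Theory.
Local Open Scope ring_scope.

Record Grp := Grp_ {
  gcar :> Type;
  gmul : gcar -> gcar -> gcar;
  gone : gcar;
  ginv : gcar -> gcar;
  gmulA : forall x y z, gmul x (gmul y z) = gmul (gmul x y) z;
  gmul1 : forall x, gmul gone x = x;
  gmulV : forall x, gmul (ginv x) x = gone }.

Definition is_hom (G H : Grp) (f : G -> H) : Prop :=
  forall x y, f (gmul x y) = gmul (f x) (f y).

Definition is_free_product (G : Grp) (I : Type) (Gi : I -> Grp) : Prop :=
  exists iota : forall i, Gi i -> G,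
    (forall i, is_hom (iota i)) /\
    forall (H : Grp) (fi : forall i, Gi i -> H),
      (forall i, is_hom (fi i)) ->
      exists f : G -> H,
        (is_hom f /\ forall i x, f (iota i x) = fi i x) /\
        forall f' : G -> H, is_hom f' -> (forall i x, f' (iota i x) = fi i x) ->
          forall y, f' y = f y.

Definition countable_index (I : Type) : Prop :=
  exists e : I -> nat, forall i j, e i = e j -> i = j.

Definition finite_grp (G : Grp) : Prop := exists s : list G, forall x, In x s.

Definition iso_to_Z (G : Grp) : Prop :=
  exists phi : int -> G,
    (forall a b : int, phi (a + b) = gmul (phi a) (phi b)) /\
    (forall a b, phi a = phi b -> a = b) /\
    (forall x, exists a, phi a = x).

Lemma int_addA (x y z : int) : x + (y + z) = (x + y) + z.
Proof. exact: addrA. Qed.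
Lemma int_add0 (x : int) : 0 + x = x.
Proof. exact: add0r. Qed.
Lemma int_addN (x : int) : - x + x = 0.
Proof. exact: addNr. Qed.
Definition intGrp : Grp := @Grp_ int +%R 0 -%R int_addA int_add0 int_addN.

(* elements are pairs (f, g) with f : G -> A finitely supported, g in G *)
Definition finsupp (A : zmodType) (G : Type) (f : G -> A) : Prop :=
  exists s : list G, forall x, f x != 0 -> In x s.

(* (f, g) * (f', g') = (f + g.f', g g') with (g.f')(x) = f'(g^-1 x) *)
Definition wr_fun (A : zmodType) (G : Grp) (f : G -> A) (g : G) (f' : G -> A) :
  G -> A := fun x => f x + f' (gmul (ginv g) x).

Section Shift.
Variable Sigma : finType.

(* x and y agree on the window [-N, N] (cylinder neighbourhoods of the
   product topology, Sigma discrete) *)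
Definition agree (N : nat) (x y : int -> Sigma) : Prop :=
  forall i : int, (`|i| <= N)%N -> x i = y i.

Definition cont_map (F : (int -> Sigma) -> (int -> Sigma)) : Prop :=
  forall x (M : nat), exists N : nat, forall y, agree N x y -> agree M (F x) (F y).

Definition cont_int (c : (int -> Sigma) -> int) : Prop :=
  forall x, exists N : nat, forall y, agree N x y -> c y = c x.

Definition shift (n : int) (x : int -> Sigma) : int -> Sigma := fun i => x (i + n).

Definition homeo (F : (int -> Sigma) -> (int -> Sigma)) : Prop :=
  cont_map F /\ exists F' : (int -> Sigma) -> (int -> Sigma),
    cont_map F' /\ (forall x, F' (F x) = x) /\ (forall x, F (F' x) = x).

Definition in_full_group (F : (int -> Sigma) -> (int -> Sigma)) : Prop :=
  homeo F /\ exists c : (int -> Sigma) -> int,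
    cont_int c /\ forall x, F x = shift (c x) x.
End Shift.

Definition wreath_embeds (A : zmodType) (G : Grp) (Sigma : finType) : Prop :=
  exists phi : (G -> A) -> G -> ((int -> Sigma) -> (int -> Sigma)),
    (forall f g, finsupp f -> in_full_group (phi f g)) /\
    (forall f g f' g', finsupp f -> finsupp f' ->
       (forall x, phi f g x = phi f' g' x) -> (forall y, f y = f' y) /\ g = g') /\
    (forall f g f' g', finsupp f -> finsupp f' ->
       forall x, phi (wr_fun f g f') (gmul g g') x = phi f g (phi f' g' x)).

(* Main.v *)
From HB Require Import structures.
Require Import Defs.
From mathcomp Require Import all_boot all_order all_algebra.
From mathcomp Require Import all_fingroup.
From mathcomp Require Import zify boolp classical_sets fsbigop.
Set Implicit Arguments. Unset Strict Implicit. Unset Printing Implicit Defensive.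
Import Order.TTheory GRing.Theory Num.Theory.
Local Open Scope ring_scope.

(**
An element of the topological full group is a head that walks on a fixed tape,
by a rule that is local in the tape.  On the tape we read non-overlapping
"cells" [1 1 0 b 0 ... 0] carrying a bit [b]; a "gap" of length [k] is a
1-cell followed by [k] 0-cells and a 1-cell.  The letters of the free product
of countably many copies of all symmetric groups are coded injectively by gap
lengths, and the group [K_j] acts regularly on suitable cells of a gap coding
[g] in [K_j], the identity being at its first cell and [g] at its last one, so
that [g] carries the head across the gap.  Hence a reduced word can be spelled
on a tape, and it moves the head from the beginning to the end, while no other
word that is not longer does the same: the action of the free product is
faithful.  An infinite cyclic factor is generated by the product of two
involutions taken from different factors.

Each cell is long enough to contain a copy of [A], on which the free product
acts trivially.  The lamp group [A] translates these copies at the cells that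
begin a gap of length 0, and the conjugates of this action by distinct elements
of [G] commute because none of them moves the head to another cell.  A nonzero
finitely supported function is seen to act nontrivially on the tape that spells
the longest word among the inverses of its support and ends with a lamp.
*)

(** * Cells and gaps *)

Section Tape.
Variables (Sigma : finType) (a0 a1 : Sigma) (n : nat).
Hypotheses (a01 : a0 != a1) (n_ge5 : (4 < n)%N).
Local Notation tape := (int -> Sigma).

Definition pat (b : bool) (r : nat) : Sigma :=
  if (r < 2)%N || (r == 3) && b then a1 else a0.

Definition mk (x : tape) (b : bool) (q : int) : bool :=
  [forall r : 'I_n, x (q + r%:Z) == pat b r].

Lemma mkE x b q r : mk x b q -> (r < n)%N -> x (q + r%:Z) = pat b r.
Proof. by move=> /forallP h rn; apply/eqP: (h (Ordinal rn)). Qed.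

Lemma mk_shift m x b q : mk (shift m x) b q = mk x b (q + m).
Proof. by apply: eq_forallb => r; rewrite /shift addrAC. Qed.

(* A cell starts with [a1 a1] and no proper suffix of a cell starts like that. *)
Lemma mk_nonoverlap x b b' q r :
  (r < n)%N -> mk x b q -> mk x b' (q + r%:Z) -> r = 0%N /\ b = b'.
Proof.
move=> rn hq hr.
have G k l : k = (r + l)%N -> (k < n)%N -> (l < n)%N -> pat b k = pat b' l.
  move=> e kn ln; rewrite -(mkE hq kn) -(mkE hr ln); congr x; lia.
have a10 : a1 <> a0 by move=> e; move/eqP: a01; rewrite e.
case: r rn hr G => [|[|[|[|r]]]] rn hr G.
- split=> //; have := G 3 3 erefl; rewrite /pat /=.
  case: b b' {hq hr G} => [] [] // h; have e := h ltac:(lia) ltac:(lia).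
    by case: a10.
  by case: a10.
- by have := G 2 1 erefl ltac:(lia) ltac:(lia); rewrite /pat /= => e; case: a10.
- by have := G 2 0 erefl ltac:(lia) ltac:(lia); rewrite /pat /= => e; case: a10.
(* The bit of the first cell may be [a1], so the comparison is made one place further; this is where
   [n] has to exceed 4. *)
- by have := G 4 1 erefl ltac:(lia) ltac:(lia); rewrite /pat /= => e; case: a10.
- by have := G r.+4 0 ltac:(lia) rn ltac:(lia); rewrite /pat /= => e; case: a10.
Qed.

Definition gap (x : tape) (s : int) (k : nat) : bool :=
  [&& mk x true s, [forall i : 'I_k, mk x false (s + (n * i.+1)%:Z)]
    & mk x true (s + (n * k.+1)%:Z)].

Lemma gap_shift m x s k : gap (shift m x) s k = gap x (s + m) k.
Proof.
rewrite /gap !mk_shift; congr [&& _, _ & mk _ _ _]; last by rewrite addrAC.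
by apply: eq_forallb => i; rewrite mk_shift addrAC.
Qed.

Lemma gap_end x s k : gap x s k -> mk x true (s + (n * k.+1)%:Z).
Proof. by case/and3P. Qed.

Lemma gap_cell x s k i : gap x s k -> (i <= k)%N -> mk x (i == 0%N) (s + (n * i)%:Z).
Proof.
case/and3P => h0 /forallP h _; case: i => [|i] ik; first by rewrite muln0 addr0.
exact: (h (Ordinal ik)).
Qed.

(** Dividing [t - s] by [n] places [t] in one of the cells of the gap, and non-overlap makes the
    remainder zero. *)
Lemma gap_inside x s k b t :
  gap x s k -> mk x b t -> s <= t -> t < s + (n * k.+1)%:Z ->
  exists i, [/\ (i <= k)%N, t = s + (n * i)%:Z & b = (i == 0%N)].
Proof.
move=> hg ht st ts.
have [d td] : exists d : nat, t = s + d%:Z by exists `|t - s|%N; lia.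
have hd : (d < k.+1 * n)%N by rewrite mulnC; lia.
have ik : (d %/ n < k.+1)%N by rewrite ltn_divLR //; lia.
have e : (d = n * (d %/ n) + d %% n)%N by rewrite mulnC -divn_eq.
have et : t = s + (n * (d %/ n))%:Z + (d %% n)%:Z by rewrite {}td {1}e; lia.
have rn : (d %% n < n)%N by rewrite ltn_mod; lia.
rewrite et in ht.
have [r0 bb] := mk_nonoverlap rn (gap_cell hg ik) ht.
by exists (d %/ n)%N; split => //; rewrite et r0 addr0.
Qed.

(** The closing 1-cell of the shorter gap would lie inside the longer one, whose cells after the
    first carry 0. *)
Lemma gap_inj x s k k' : gap x s k -> gap x s k' -> k = k'.
Proof.
wlog kk : k k' / (k < k')%N.
  by move=> W h h'; case: (ltngtP k k') => // l; [|symmetry]; exact: W.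
move=> h h'; have [||i [_ e1 e2]] := gap_inside h' (gap_end h); [lia|nia|].
have : (n * k.+1 = n * i)%N by lia.
by case: i e2 {e1} => // _; lia.
Qed.

End Tape.

(** * Locally constant functions of the tape *)

Section LocallyConstant.
Variable Sigma : finType.
Local Notation tape := (int -> Sigma).

Definition lc T (f : tape -> T) : Prop :=
  forall x, exists N : nat, forall y, agree N x y -> f y = f x.

Lemma agree_le (N M : nat) (x y : tape) : (M <= N)%N -> agree N x y -> agree M x y.
Proof. by move=> MN h i iM; apply: h; apply: leq_trans MN. Qed.

Lemma agree_shift (N : nat) (m : int) (x y : tape) :
  agree (N + `|m|) x y -> agree N (shift m x) (shift m y).
Proof. by move=> h i iN; apply: h; lia. Qed.

Lemma lc_const T (c : T) : lc (fun=> c).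
Proof. by move=> x; exists 0%N. Qed.

Lemma lc_coord (q : int) : lc (fun x => x q).
Proof. by move=> x; exists `|q|%N => y h; rewrite h. Qed.

(** This covers reading the tape at a place that depends on the tape: near [x] only the map
    [g (f x)] matters. *)
Lemma lc_bind S T (f : tape -> S) (g : S -> tape -> T) :
  lc f -> (forall v, lc (g v)) -> lc (fun x => g (f x) x).
Proof.
move=> hf hg x; have [N hN] := hf x; have [M hM] := hg (f x) x.
exists (maxn N M) => y h; rewrite hN ?hM //; apply: agree_le h; lia.
Qed.

Lemma lc_map S T (h : S -> T) (f : tape -> S) : lc f -> lc (fun x => h (f x)).
Proof. by move=> hf; apply: (lc_bind (g := fun v _ => h v)) hf _ => v; apply: lc_const. Qed.

Lemma lc_map2 S S' T (h : S -> S' -> T) (f : tape -> S) (g : tape -> S') :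
  lc f -> lc g -> lc (fun x => h (f x) (g x)).
Proof. by move=> hf hg; apply: (lc_bind (g := fun v x => h v (g x))) hf _ => v; apply: lc_map. Qed.

Lemma lc_family (I : finType) T (f : I -> tape -> T) : (forall i, lc (f i)) ->
  forall x, exists N : nat, forall y, agree N x y -> forall i, f i y = f i x.
Proof.
move=> hf x.
have [N hN] : exists N : nat, forall y, agree N x y -> forall i, i \in enum I -> f i y = f i x.
  elim: (enum I) => [|i s [N hN]]; first by exists 0%N.
  have [M hM] := hf i x; exists (maxn N M) => y h k; rewrite inE => /predU1P[->|ks].
    by apply: hM; apply: agree_le h; lia.
  by apply: hN => //; apply: agree_le h; lia.
by exists N => y h i; apply: hN => //; rewrite mem_enum.
Qed.

Lemma lc_forall (I : finType) (p : I -> tape -> bool) :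
  (forall i, lc (p i)) -> lc (fun x => [forall i, p i x]).
Proof.
move=> hp x; have [N hN] := lc_family hp x.
by exists N => y h; apply: eq_forallb => i; apply: hN.
Qed.

Lemma lc_pick (I : finType) (p : I -> tape -> bool) :
  (forall i, lc (p i)) -> lc (fun x => [pick i | p i x]).
Proof.
move=> hp x; have [N hN] := lc_family hp x.
by exists N => y h; apply: eq_pick => i; apply: hN.
Qed.

End LocallyConstant.

Lemma lc_sum (Sigma : finType) (A : zmodType) T (s : seq T) (F : T -> (int -> Sigma) -> A) :
  (forall z, lc (F z)) -> lc (fun x => \sum_(z <- s) F z x).
Proof.
move=> hF; elim: s => [|z s IH].
  by move=> x; exists 0%N => y _; rewrite !big_nil.
move=> x; have [N hN] := lc_map2 +%R (hF z) IH x.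
by exists N => y h; rewrite !big_cons hN.
Qed.

(** * Cellular maps and the actions of the factors on blocks *)

Section Moves.
Variables (Sigma : finType) (a0 a1 : Sigma) (n : nat).
Local Notation tape := (int -> Sigma).
Local Notation mk := (@mk Sigma a0 a1 n).
Local Notation gap := (@gap Sigma a0 a1 n).

Lemma lc_mk b q : lc (fun x => mk x b q).
Proof.
by apply: lc_forall => r; apply: (lc_map (fun c => c == pat a0 a1 b r)); apply: lc_coord.
Qed.

Lemma lc_gap s k : lc (fun x => gap x s k).
Proof.
apply: (lc_map2 (andb)); first exact: lc_mk.
apply: (lc_map2 (andb)); last exact: lc_mk.
by apply: lc_forall => i; apply: lc_mk.
Qed.

(** A head at [q] goes to [f x q]. Equivariance allows shifting the tape instead of moving the head,
    local constancy gives continuity, and preserving cells makes room for the lamps. *)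
Record cellular (f : tape -> int -> int) : Prop := Cellular {
  cellular_shift : forall x m q, f (shift m x) q + m = f x (q + m);
  cellular_lc : forall q, lc (f^~ q);
  cellular_mk : forall x b q, mk x b q -> exists b', mk x b' (f x q) }.

Lemma cellular_id : cellular (fun _ q => q).
Proof. by split=> // [q|x b q h]; [apply: lc_const | exists b]. Qed.

Lemma cellular_comp f g : cellular f -> cellular g -> cellular (fun x q => f x (g x q)).
Proof.
move=> hf hg; split=> [x m q|q|x b q h].
- by rewrite (cellular_shift hf) (cellular_shift hg).
- by apply: (lc_bind (g := fun v x => f x v)) (cellular_lc hg q) _ => v; apply: (cellular_lc hf).
- by have [b' h'] := cellular_mk hg h; apply: (cellular_mk hf h').
Qed.

Variables (J : countType) (K : J -> finGroupType).
Definition letter := {j : J & K j}.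
HB.instance Definition _ := Countable.copy letter {j : J & K j}.

Definition ltr j (g : K j) : letter := Tagged (fun j => K j) g.

(** The odd factor exceeds the order of the group, which leaves enough cells for its elements; the
    exponent of 2 identifies the letter. *)
Definition code (l : letter) : nat := 2 ^ pickle l * (#|K (tag l)|.*2.+1).

Lemma code_inj : injective code.
Proof.
have log0 m : logn 2 m.*2.+1 = 0%N.
  by apply: logn_coprime; rewrite coprime2n /= odd_double.
move=> l l' /(congr1 (logn 2)); rewrite !lognM ?expn_gt0 // !pfactorK // !log0 !addn0.
exact: (pcan_inj pickleK).
Qed.

Lemma code_ge l : (#|K (tag l)| <= code l)%N.
Proof.
rewrite /code; have : (0 < 2 ^ pickle l)%N by rewrite expn_gt0.
move: (2 ^ _)%N => c c0; apply: leq_trans (leq_pmull _ c0); lia.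
Qed.

Lemma code_gt0 l : (0 < code l)%N.
Proof. by rewrite /code muln_gt0 expn_gt0. Qed.

Lemma ltr_inj j : injective (@ltr j).
Proof. by move=> g g' /eqP; rewrite eq_Tagged => /eqP. Qed.

(* The end cell of a gap also starts the next gap, so of two consecutive gaps
   of the same type only the second one may be used. *)
Definition block x j (g : K j) s : bool :=
  gap x s (code (ltr g)) &&
  [forall g' : K j, ~~ gap x (s + (n * (code (ltr g)).+1)%:Z) (code (ltr g'))].

Lemma block_shift m x j (g : K j) s : block (shift m x) g s = block x g (s + m).
Proof.
rewrite /block gap_shift; congr (_ && _); apply: eq_forallb => g'.
by rewrite gap_shift addrAC.
Qed.

Lemma lc_block j (g : K j) s : lc (fun x => block x g s).
Proof.
apply: (lc_map2 (andb)); first exact: lc_gap.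
by apply: lc_forall => g'; apply: (lc_map (negb)); apply: lc_gap.
Qed.

(* The cell of the block of [g] at which [h] sits: [1] at the start, [g] at the end. *)
Definition idx j (g h : K j) : nat :=
  if h == 1%g then 0%N else if h == g then (code (ltr g)).+1 else (enum_rank h).+1.

Lemma rank_code j (g h : K j) : (enum_rank h < code (ltr g))%N.
Proof. exact: leq_trans (ltn_ord _) (code_ge (ltr g)). Qed.

Lemma idx_le j (g h : K j) : (idx g h <= (code (ltr g)).+1)%N.
Proof. rewrite /idx; have := rank_code g h; case: ifP => // _; case: ifP => // _; lia. Qed.

Lemma idx_inj j (g : K j) : injective (idx g).
Proof.
move=> h h'; rewrite /idx; have := rank_code g h; have := rank_code g h'.
have [->|_] := eqVneq h 1%g; have [->|_] := eqVneq h' 1%g => //; try by case: ifP.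
have [->|_] := eqVneq h g; have [->|_] := eqVneq h' g => //; try lia.
by move=> _ _ [] /val_inj /enum_rank_inj.
Qed.

Lemma idx_end j (g h : K j) : idx g h = (code (ltr g)).+1 -> h = g /\ g != 1%g.
Proof.
rewrite /idx; case: (eqVneq h 1%g) => // h1; case: (eqVneq h g) => [<-|_] // [e].
by have := rank_code g h; rewrite e ltnn.
Qed.

Definition site j (g h : K j) (s : int) : int := s + (n * idx g h)%:Z.

Lemma block_site x j (g h : K j) s : block x g s -> exists b, mk x b (site g h s).
Proof.
case/andP=> hg _; rewrite /site; have := idx_le g h.
rewrite leq_eqVlt => /predU1P[->|]; first by exists true; apply: gap_end.
by rewrite ltnS => l; eexists; apply: gap_cell hg l.
Qed.

Hypotheses (a01 : a0 != a1) (n_ge5 : (4 < n)%N).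

(** Take [s <= s']. The 1-cell at [s'] lies on the first gap; [block] forbids that it be its end, so
    it is its start. Then the gap lengths agree and [code] gives back the letter. *)
Lemma block_uniq x j (g h g' h' : K j) s s' :
  block x g s -> block x g' s' -> site g h s = site g' h' s' -> [/\ g = g', h = h' & s = s'].
Proof.
wlog ss : g h g' h' s s' / s <= s'.
  move=> W b b' e; case: (lerP s s') => l; first exact: W.
  by have [-> -> ->] := W _ _ _ _ _ _ (ltW l) b' b (esym e).
move=> b b' e; have := b; have := b' => /andP[hg' _] /andP[hg /forallP hn].
rewrite /site in e.
have := idx_le g h => ih.
have mk' : mk x true s' by have := gap_cell hg' (leq0n _); rewrite muln0 addr0.
have : s' <= s + (n * (code (ltr g)).+1)%:Z by nia.
rewrite le_eqVlt => /predU1P[es|ls]; first by have := hn g'; rewrite -es hg'.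
have [i [_ es ei]] := gap_inside a01 n_ge5 hg mk' ss ls.
case: i es ei => // es _; rewrite muln0 addr0 in es; subst s'.
have eg : g = g' by apply/ltr_inj/code_inj/(gap_inj a01 n_ge5 hg hg').
subst g'; split => //; apply: (idx_inj (g := g)).
have : (n * idx g h = n * idx g h')%N by lia.
by nia.
Qed.

Definition on_site x j q (gh : K j * K j) : bool :=
  block x gh.1 (q - (n * idx gh.1 gh.2)%:Z).

(** By [block_uniq] at most one pair qualifies, so [pick] makes no real choice. *)
Definition move j (u : K j) x q : int :=
  if [pick gh | on_site x q gh] is Some gh
  then site gh.1 (u * gh.2)%g (q - (n * idx gh.1 gh.2)%:Z) else q.

Variant move_spec j (u : K j) x q : int -> Prop :=
  | MoveSite (g h : K j) s of block x g s & q = site g h s : move_spec u x q (site g (u * h)%g s)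
  | MoveFix of (forall (g h : K j) s, block x g s -> q <> site g h s) : move_spec u x q q.

Lemma moveP j (u : K j) x q : move_spec u x q (move u x q).
Proof.
rewrite /move; case: pickP => [[g h] hb|hb]; first by constructor => //=; rewrite /site subrK.
constructor => g h s bs e; have := hb (g, h).
by rewrite /on_site /= e /site addrK bs.
Qed.

Lemma move_site j (u g h : K j) x s : block x g s -> move u x (site g h s) = site g (u * h)%g s.
Proof.
move=> b; case: moveP => [g' h' s' b' e|]; last by move=> /(_ g h s b) [].
by have [-> -> ->] := block_uniq b b' e.
Qed.

Lemma moveM j (u v : K j) x q : move (u * v)%g x q = move u x (move v x q).
Proof.
case: (moveP v x q) => [g h s b ->|hb]; first by rewrite !move_site // mulgA.
case: moveP => [g h s b e|_]; first by case: (hb _ _ _ b e).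
by case: moveP => // g h s b e; case: (hb _ _ _ b e).
Qed.

Lemma move1 j x q : move (1%g : K j) x q = q.
Proof. by case: moveP => // g h s b ->; rewrite mul1g. Qed.

Lemma cellular_move j (u : K j) : cellular (move u).
Proof.
split=> [x m q|q|x b q h].
- have e : [pick gh | on_site (shift m x) q gh] = [pick gh : K j * K j | on_site x (q + m) gh].
    by apply: eq_pick => gh; rewrite /on_site block_shift addrAC.
  by rewrite /move e; case: pickP => [gh _|//]; rewrite /site addrAC; congr (_ + _); rewrite addrAC.
- apply: (lc_map (fun o => if o is Some gh
    then site gh.1 (u * gh.2)%g (q - (n * idx gh.1 gh.2)%:Z) else q)).
  by apply: lc_pick => gh; apply: lc_block.
- case: moveP => [g k s bl _|_]; first exact: block_site.
  by exists b.
Qed.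

End Moves.

(** * Words and their tapes *)

Section Words.
Variables (Sigma : finType) (a0 a1 : Sigma) (n : nat).
Hypotheses (a01 : a0 != a1) (n_ge5 : (4 < n)%N).
Variables (J : countType) (K : J -> finGroupType).
Local Notation tape := (int -> Sigma).
Local Notation mk := (@mk Sigma a0 a1 n).
Local Notation gap := (@gap Sigma a0 a1 n).
Local Notation block x g s := (@block Sigma a0 a1 n J K x _ g s).
Local Notation move := (@move Sigma a0 a1 n J K _).
Local Notation letter := (@letter J K).
Implicit Types (x : tape) (w v : seq letter).

(** The first letter acts first, so a word reads a product of the group from right to left. *)
Definition run x w (q : int) : int := foldl (fun q (l : letter) => move (tagged l) x q) q w.

Lemma run_cat x w v q : run x (w ++ v) q = run x v (run x w q).
Proof. exact: foldl_cat. Qed.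

Definition reduced w : bool :=
  all (fun l : letter => tagged l != 1%g) w && sorted (fun l l' : letter => tag l != tag l') w.

Definition len w : nat := n * sumn [seq (code l).+1 | l <- w].

Lemma len_cons l w : len (l :: w) = (n * (code l).+1 + len w)%N.
Proof. by rewrite /len /= mulnDr. Qed.

Lemma len_rcons w l : len (rcons w l) = (len w + n * (code l).+1)%N.
Proof. by rewrite /len map_rcons sumn_rcons mulnDr. Qed.

(* The final gap of length 0 is the lamp. *)
Fixpoint spells x (s : int) w : bool :=
  if w is l :: w' then gap x s (code l) && spells x (s + (n * (code l).+1)%:Z) w'
  else gap x s 0.

Lemma spells_mk x s w v : spells x s (w ++ v) -> mk x true (s + (len w)%:Z).
Proof.
elim: w s => [|l w IH] s /=.
  rewrite /len /= muln0 addr0; case: v => [|l v] /=; first by case/and3P.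
  by case/andP => /and3P[].
by case/andP => _ /IH; rewrite len_cons PoszD addrA.
Qed.

Lemma spells_gap x s w l v : spells x s (w ++ l :: v) -> gap x (s + (len w)%:Z) (code l).
Proof.
elim: w s => [|l' w IH] s /=; first by rewrite /len /= muln0 addr0; case/andP.
by case/andP => _ /IH; rewrite len_cons PoszD addrA.
Qed.

(** Gap lengths determine letters, and the lamp has length 0 while codes are positive. This supplies
    the second condition of [block] along a reduced word. *)
Lemma spells_no_gap x s w j (g : K j) :
  spells x s w -> (if w is l :: _ then j != tag l else true) -> ~~ gap x s (code (ltr g)).
Proof.
case: w => [|l w] /= h hj; apply/negP => hg.
  by have := code_gt0 (ltr g); rewrite (gap_inj a01 n_ge5 hg h).
case/andP: h => h _; have /code_inj e := gap_inj a01 n_ge5 hg h.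
by move: hj; rewrite -e eqxx.
Qed.

(** Each letter [g] carries the start of its block, the site of [1], to the end, the site of [g]. *)
Lemma run_spells x s w : reduced w -> spells x s w -> run x w s = s + (len w)%:Z.
Proof.
elim: w s => [|[j g] w IH] s; first by rewrite /len /= muln0 addr0.
rewrite /reduced /= => /andP[/andP[g1 aw] pw] /andP[hg hw].
have b : block x g s.
  apply/andP; split=> //; apply/forallP => g'; apply: spells_no_gap hw _.
  by case: (w) pw => //= l v /andP[].
have -> : move g x s = s + (n * (code (ltr g)).+1)%:Z.
  rewrite -{1}[s](_ : site n g 1%g s = s); last by rewrite /site /idx eqxx muln0 addr0.
  by rewrite (move_site a01 n_ge5) // mulg1 /site /idx (negPf g1) eqxx.
rewrite IH //; first by rewrite len_cons PoszD addrA.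
by rewrite /reduced aw (path_sorted pw).
Qed.

(** By induction on the last letter. A block that starts before a boundary between spelled gaps
    cannot extend past that 1-cell, so one letter never carries the head beyond the next
    boundary. *)
Lemma run_range x : (forall b q, mk x b q -> 0 <= q) ->
  forall v w w', spells x 0 (w ++ w') -> size v = size w ->
  [/\ 0 <= run x v 0, run x v 0 <= (len w)%:Z & (run x v 0 = (len w)%:Z -> v = w)].
Proof.
move=> x_ge0; elim/last_ind => [|v [j u] IH] w w'; first by case: w => // _ _; rewrite /len muln0.
case/lastP: w => [|w l]; rewrite ?size_rcons // cat_rcons => hw [sz].
have [q0 qS qE] := IH w (l :: w') hw sz.
rewrite -cats1 run_cat /= cats1; move: q0 qS qE; set q := run x v 0 => q0 qS qE.
have := spells_gap hw; rewrite add0r => hS.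
have mS : mk x true (len w)%:Z by rewrite -[_%:Z]add0r; apply: spells_mk hw.
rewrite len_rcons; case: moveP => [g h s b e|_]; last by split; [lia|nia|nia].
have /andP[hg _] := b; have s0 : 0 <= s by apply: (x_ge0 true); case/and3P: hg.
have := idx_le g (u * h)%g => iuh.
have s'0 : 0 <= site n g (u * h)%g s by rewrite /site; lia.
have sq : s <= q by rewrite e /site; lia.
case: (ltrgtP s (len w)%:Z) => [sS|sS|es]; last 1 first.
(* The block is the gap of [l]. The head stands at its start, so [h = 1] and [v = w] by induction;
   reaching its end then forces [u = g]. *)
- subst s; have /code_inj el := gap_inj a01 n_ge5 hS hg; subst l.
  split; rewrite ?PoszD /site /= in s'0 *; [by []|by nia|].
  move=> e'; have /idx_end[ug g1] : idx g (u * h)%g = (code (ltr g)).+1 by nia.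
  have h1 : h = 1%g.
    by apply: (idx_inj (g := g)); rewrite {2}/idx eqxx; move: e; rewrite /site; nia.
  have -> : v = w by apply: qE; rewrite e h1 /site /idx eqxx; lia.
  by congr rcons; rewrite -ug h1 mulg1.
- have eS : s + (n * (code (ltr g)).+1)%:Z <= (len w)%:Z.
    rewrite leNgt; apply/negP => lt.
    have [i [_ ei i0]] := gap_inside a01 n_ge5 hg mS (ltW sS) lt.
    by case: i ei i0 => // ei _; rewrite ei muln0 addr0 ltxx in sS.
  have le : site n g (u * h)%g s <= (len w)%:Z by apply: le_trans eS; rewrite /site; nia.
  by split; [lia|lia|nia].
- lia.
Qed.

Lemma len_lt w v : (0 < n)%N -> v != [::] -> (len w < len (w ++ v))%N.
Proof. by move=> n0; case: v => // l v _; rewrite /len map_cat sumn_cat /=; nia. Qed.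

(** The prefix of [w] of the size of [v] bounds the head by its own length, which is too short
    unless the prefix is all of [w]. *)
Lemma run_unique x w v : (forall b q, mk x b q -> 0 <= q) -> spells x 0 w ->
  (size v <= size w)%N -> run x v 0 = (len w)%:Z -> v = w.
Proof.
move=> x_ge0; rewrite -{1 3}(cat_take_drop (size v) w) => hw szv e.
have sz : size v = size (take (size v) w) by rewrite size_takel.
have [_ le eq] := run_range x_ge0 hw sz.
have d0 : drop (size v) w = [::].
  apply/eqP/negPn/negP => d; have := len_lt (take (size v) w) (ltnW (ltnW (ltnW (ltnW n_ge5)))) d.
  by rewrite e in le; lia.
rewrite d0 cats0 in e; rewrite (eq e); have := cat_take_drop (size v) w.
by rewrite d0 cats0.
Qed.

(** A gap of length 0 begins with a 1-cell. Before the end of the spelling the 1-cells are starts of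
    letter gaps, which have positive length. *)
Lemma spells_lamp x s w q : spells x s w -> s <= q -> q <= s + (len w)%:Z ->
  gap x q 0 -> q = s + (len w)%:Z.
Proof.
move=> + + + hq; have mq : mk x true q by case/and3P: hq.
elim: w s => [|l w IH] s /=; first by rewrite /len muln0; lia.
case/andP=> hg hw sq; rewrite len_cons PoszD addrA => qe.
case: (lerP (s + (n * (code l).+1)%:Z) q) => [|lt]; first by move=> h; apply: IH.
have [i [_ ei i0]] := gap_inside a01 n_ge5 hg mq sq lt.
case: i ei i0 => // ei _; rewrite muln0 addr0 in ei; subst q.
by have := code_gt0 l; rewrite -(gap_inj a01 n_ge5 hq hg).
Qed.

(** The closing 1-cell of a gap is the first bit of what follows; the base case is the lamp. *)
Definition bits w : seq bool :=
  foldr (fun l s => true :: nseq (code l) false ++ s) [:: true; true] w.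

Lemma spells_bits x (y : nat -> bool) w t0 : (forall t, mk x (y t) (n * t)%:Z) ->
  (forall t, (t < size (bits w))%N -> y (t0 + t)%N = nth false (bits w) t) ->
  spells x (n * t0)%:Z w.
Proof.
move=> hy; elim: w t0 => [|l w IH] t0 /= yE.
  have y0 := yE 0%N erefl; have y1 := yE 1%N erefl.
  rewrite /= addn0 in y0; rewrite /= addn1 in y1.
  apply/and3P; split; [by rewrite -[true]y0|by apply/forallP => -[]|].
  by rewrite -PoszD -mulnDr addn1 -[true]y1.
have sz : (0 < size (bits w))%N by case: (w).
have y0 : y t0 = true by rewrite -[t0]addn0 yE.
have yk : y (t0 + (code l).+1)%N = true.
  rewrite yE /=; last by rewrite size_cat size_nseq; lia.
  by rewrite nth_cat size_nseq ltnn subnn; case: (w).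
rewrite -PoszD -mulnDr IH ?andbT; last first.
  move=> t tw; rewrite -addnA yE /= ?size_cat ?size_nseq; last by lia.
  by rewrite ?addSn /= nth_cat size_nseq ltnNge leq_addr /= addKn.
apply/and3P; split; rewrite -?PoszD -?mulnDr; [by rewrite -[true]y0| |by rewrite -[true]yk].
apply/forallP => -[i ik] /=; rewrite -PoszD -mulnDr.
have <- : y (t0 + i.+1)%N = false; last exact: hy.
by rewrite yE /= ?nth_cat ?size_cat size_nseq ?ik ?nth_nseq ?ik //; lia.
Qed.

(** Having no cell on the negative side bounds the head from below; aperiodicity lets a displacement
    be read off from the shifted tape. *)
Lemma spelling_tape w : exists x,
  [/\ spells x 0 w, forall b q, mk x b q -> 0 <= q & injective (fun m => shift m x)].
Proof.
have n0 : (0 < n)%N by lia.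
(* Past the end of [bits w] the default value of [nth] continues the tape with 0-cells. *)
pose x (i : int) := if i is Posz k then pat a0 a1 (nth false (bits w) (k %/ n)) (k %% n) else a0.
have xneg i : i < 0 -> x i = a0 by case: i.
have x0 : x 0 = a1 by rewrite /x /= mod0n.
exists x; split=> [|b q h|m m' e].
- rewrite -[0](_ : (n * 0)%:Z = 0); last by rewrite muln0.
  apply: (@spells_bits _ (nth false (bits w))) => // t.
  apply/forallP => -[r rn]; apply/eqP.
  rewrite -[LHS]/(pat a0 a1 (nth false (bits w) ((n * t + r) %/ n)) ((n * t + r) %% n)).
  by rewrite mulnC divnMDl // modnMDl divn_small // modn_small // addn0.
- rewrite leNgt; apply/negP => /xneg q0.
  by have := mkE h n0; rewrite addr0 q0 /pat /= => e; move: a01; rewrite e eqxx.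
(* The leftmost [a1] of the tape is at 0, so distinct shifts differ. *)
- have lt_shift k k' : k < k' -> shift k x <> shift k' x.
    move=> lt /(congr1 (fun y => y (- k'))); rewrite /shift addNr x0 xneg; last lia.
    by move=> e'; move: a01; rewrite e' eqxx.
  by case: (ltgtP m m') => // /lt_shift; rewrite e.
Qed.

End Words.

(** * Free products *)

Section GrpTheory.
Variable G : Grp.
Implicit Types u v : G.

Lemma gmulKl u v : gmul (ginv u) (gmul u v) = v.
Proof. by rewrite gmulA gmulV gmul1. Qed.

Lemma gmulI u : injective (gmul u).
Proof. by move=> v w e; rewrite -[v](gmulKl u) e gmulKl. Qed.

Lemma gmulr1 u : gmul u (gone G) = u.
Proof. by apply: (@gmulI (ginv u)); rewrite gmulA !gmulV gmul1. Qed.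

Lemma gmulrV u : gmul u (ginv u) = gone G.
Proof. by apply: (@gmulI (ginv u)); rewrite gmulA gmulV gmul1 gmulr1. Qed.

Lemma gmulrK u v : gmul (gmul v u) (ginv u) = v.
Proof. by rewrite -gmulA gmulrV gmulr1. Qed.

Lemma ginv_uniq u v : gmul v u = gone G -> v = ginv u.
Proof. by move=> e; rewrite -[v](gmulrK u) e gmul1. Qed.

Lemma ginvK u : ginv (ginv u) = u.
Proof. by symmetry; apply: ginv_uniq; apply: gmulrV. Qed.

Lemma ginvM u v : ginv (gmul u v) = gmul (ginv v) (ginv u).
Proof. by symmetry; apply: ginv_uniq; rewrite -gmulA gmulKl gmulV. Qed.

Lemma ginv_one : ginv (gone G) = gone G.
Proof. by symmetry; apply: ginv_uniq; apply: gmul1. Qed.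

Definition gpow u (m : int) : G :=
  match m with
  | Posz k => iter k (fun v => gmul v u) (gone G)
  | Negz k => iter k.+1 (fun v => gmul v (ginv u)) (gone G)
  end.

Lemma gpowS u m : gpow u (m + 1) = gmul (gpow u m) u.
Proof.
case: m => [k|[|k]]; first by rewrite -PoszD addn1.
  by rewrite /= -gmulA gmulV gmulr1.
have -> : Negz k.+1 + 1 = Negz k by lia.
by rewrite /= -[RHS]gmulA gmulV gmulr1.
Qed.

Lemma gpowB u m : gpow u (m - 1) = gmul (gpow u m) (ginv u).
Proof. by rewrite -{2}[m](subrK 1) gpowS gmulrK. Qed.

Lemma gpowD u m k : gpow u (m + k) = gmul (gpow u m) (gpow u k).
Proof.
elim: k => [|k IH|k IH]; first by rewrite addr0 gmulr1.
  by rewrite -addn1 PoszD addrA !gpowS IH gmulA.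
by rewrite -addn1 PoszD opprD addrA !gpowB IH gmulA.
Qed.

End GrpTheory.

Section Homs.
Variables (G H : Grp) (f : G -> H).
Hypothesis fM : is_hom f.

Lemma hom_one : f (gone G) = gone H.
Proof. by apply: (@gmulI _ (f (gone G))); rewrite -fM gmul1 gmulr1. Qed.

Lemma hom_inv u : f (ginv u) = ginv (f u).
Proof. by apply: ginv_uniq; rewrite -fM gmulV hom_one. Qed.

End Homs.

(** * Normal forms from the universal property *)

Section FreeProduct.
Variables (G : Grp) (I : Type) (Gi : I -> Grp) (iota : forall i, Gi i -> G).
Arguments iota : clear implicits.
Hypothesis iota_hom : forall i, is_hom (iota i).
Hypothesis universal : forall (H : Grp) (fi : forall i, Gi i -> H),
  (forall i, is_hom (fi i)) ->
  exists f : G -> H,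
    (is_hom f /\ forall i x, f (iota i x) = fi i x) /\
    forall f' : G -> H, is_hom f' -> (forall i x, f' (iota i x) = fi i x) ->
      forall y, f' y = f y.

Inductive generated : G -> Prop :=
| GenOne : generated (gone G)
| GenMul u i x : generated u -> generated (gmul u (iota i x)).

Lemma generated_mul u v : generated u -> generated v -> generated (gmul u v).
Proof.
move=> gu; elim=> [|v' i x _ IH]; first by rewrite gmulr1.
by rewrite gmulA; apply: GenMul.
Qed.

Lemma generated_inv u : generated u -> generated (ginv u).
Proof.
elim=> [|v i x _ IH]; first by rewrite ginv_one; apply: GenOne.
rewrite ginvM -(hom_inv (@iota_hom i)); apply: generated_mul => //.
by rewrite -[iota _ _]gmul1; apply/GenMul/GenOne.
Qed.

Definition generated_sub := {u : G | generated u}.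

Lemma generated_sub_inj (a b : generated_sub) : proj1_sig a = proj1_sig b -> a = b.
Proof. by case: a b => [a ha] [b hb] /= e; subst b; rewrite (Prop_irrelevance ha hb). Qed.

Definition gen_mul (a b : generated_sub) : generated_sub :=
  exist _ _ (generated_mul (proj2_sig a) (proj2_sig b)).
Definition gen_one : generated_sub := exist _ _ GenOne.
Definition gen_inv (a : generated_sub) : generated_sub :=
  exist _ _ (generated_inv (proj2_sig a)).

Lemma gen_mulA a b c : gen_mul a (gen_mul b c) = gen_mul (gen_mul a b) c.
Proof. exact/generated_sub_inj/gmulA. Qed.
Lemma gen_mul1 a : gen_mul gen_one a = a.
Proof. exact/generated_sub_inj/gmul1. Qed.
Lemma gen_mulV a : gen_mul (gen_inv a) a = gen_one.
Proof. exact/generated_sub_inj/gmulV. Qed.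
Definition generatedGrp : Grp := Grp_ gen_mulA gen_mul1 gen_mulV.

(** The factors map into the subgroup they generate, hence so does [G]; followed by the inclusion
    this is the identity, by the uniqueness clause with [G] itself as target. *)
Lemma free_product_generated u : generated u.
Proof.
have gen i x : generated (iota i x) by rewrite -[iota i x]gmul1; apply/GenMul/GenOne.
pose fi i (x : Gi i) : generatedGrp := exist generated (iota i x) (gen i x) : generated_sub.
have fiM i : is_hom (@fi i) by move=> x y; apply: generated_sub_inj; apply: iota_hom.
have [f [[fM fE] _]] := universal fiM.
have [g [_ g_uniq]] := universal iota_hom.
have e : u = proj1_sig (f u); last by rewrite e; apply: (proj2_sig (f u)).
apply: etrans (g_uniq id (fun _ _ => erefl) (fun _ _ => erefl) u) _; symmetry.
apply: (g_uniq (fun v => proj1_sig (f v))) => [v w|i x]; first by rewrite fM.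
by rewrite fE.
Qed.

Inductive normal_form : option I -> G -> Prop :=
| NormalOne : normal_form None (gone G)
| NormalMul u c i x : normal_form c u -> c <> Some i -> x <> gone (Gi i) ->
    normal_form (Some i) (gmul u (iota i x)).

Lemma normal_mul c u i x : normal_form c u -> exists c', normal_form c' (gmul u (iota i x)).
Proof.
move=> nu; have [->|x1] := EM (x = gone (Gi i)).
  by exists c; rewrite (hom_one (@iota_hom i)) gmulr1.
case: nu x x1 => [|v d j y nv dj y1] x x1.
  by exists (Some i); apply: NormalMul NormalOne _ x1.
have [e|ij] := EM (j = i); last first.
  by exists (Some i); apply: NormalMul x1; [apply: NormalMul nv dj y1|case].
subst j; rewrite -gmulA -iota_hom.
have [->|yx] := EM (gmul y x = gone _).
  by exists d; rewrite (hom_one (@iota_hom i)) gmulr1.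
by exists (Some i); apply: NormalMul nv dj yx.
Qed.

Lemma free_product_normal u : exists c, normal_form c u.
Proof.
elim: (free_product_generated u) => [|v i x _ [c nv]]; first by exists None; apply: NormalOne.
exact: normal_mul nv.
Qed.

End FreeProduct.

(** * The group of cellular bijections, and words for normal forms *)

Section CellGroup.
Variables (Sigma : finType) (a0 a1 : Sigma) (n : nat).
Local Notation tape := (int -> Sigma).
Local Notation cellular := (@cellular Sigma a0 a1 n).

(** The backward map is stored because it must be cellular too; the forward map determines it, see
    [cbij_inj]. *)
Record cbij := CBij {
  cfw :> tape -> int -> int;
  cbw : tape -> int -> int;
  cfw_cellular : cellular cfw;
  cbw_cellular : cellular cbw;
  cfwK : forall x, cancel (cfw x) (cbw x);
  cbwK : forall x, cancel (cbw x) (cfw x) }.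

Lemma cbij_inj (f g : cbij) : (forall x, f x =1 g x) -> f = g.
Proof.
move=> fg; have ef : cfw f = cfw g by apply/funext => x; apply/funext => q; apply: fg.
have eb : cbw f = cbw g.
  by apply/funext => x; apply/funext => q; rewrite -{1}[q](cbwK g x) -fg cfwK.
case: f g ef eb {fg} => [f f' h1 h2 h3 h4] [g g' k1 k2 k3 k4] /= ef eb.
by subst g g'; congr CBij; apply: Prop_irrelevance.
Qed.

Definition cbij_mul (f g : cbij) : cbij.
Proof.
refine (@CBij (fun x q => f x (g x q)) (fun x q => cbw g x (cbw f x q)) _ _ _ _).
- exact: cellular_comp (cfw_cellular f) (cfw_cellular g).
- exact: cellular_comp (cbw_cellular g) (cbw_cellular f).
- by move=> x q; rewrite !cfwK.
- by move=> x q; rewrite !cbwK.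
Defined.

Definition cbij_one : cbij :=
  CBij (cellular_id a0 a1 n) (cellular_id a0 a1 n) (fun _ _ => erefl) (fun _ _ => erefl).

Definition cbij_inv (f : cbij) : cbij :=
  CBij (cbw_cellular f) (cfw_cellular f) (cbwK f) (cfwK f).

Lemma cbij_mulA f g h : cbij_mul f (cbij_mul g h) = cbij_mul (cbij_mul f g) h.
Proof. exact: cbij_inj. Qed.
Lemma cbij_mul1 f : cbij_mul cbij_one f = f.
Proof. exact: cbij_inj. Qed.
Lemma cbij_mulV f : cbij_mul (cbij_inv f) f = cbij_one.
Proof. by apply: cbij_inj => x q; apply: cfwK. Qed.

Definition cbijGrp : Grp := Grp_ cbij_mulA cbij_mul1 cbij_mulV.

Hypotheses (a01 : a0 != a1) (n_ge5 : (4 < n)%N).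
Variables (J : countType) (K : J -> finGroupType).
Local Notation run := (@run Sigma a0 a1 n J K).
Local Notation letter := (@letter J K).

Definition cbij_move j (u : K j) : cbij.
Proof.
refine (@CBij (move a0 a1 n u) (move a0 a1 n u^-1%g) _ _ _ _).
- exact: cellular_move.
- exact: cellular_move.
- by move=> x q; rewrite -moveM // mulVg move1.
- by move=> x q; rewrite -moveM // mulgV move1.
Defined.

Lemma cbij_moveM j (u v : K j) : cbij_move (u * v)%g = cbij_mul (cbij_move u) (cbij_move v).
Proof. by apply: cbij_inj => x q; apply: moveM. Qed.

Lemma reduced_cat (w v : seq letter) : reduced w -> reduced v ->
  (forall l l' v', l \in w -> v = l' :: v' -> tag l != tag l') -> reduced (w ++ v).
Proof.
rewrite /reduced all_cat => /andP[-> sw] /andP[-> sv] wv /=.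
case: w v sw sv wv => [|l w] [|l' v] //= sw sv wv; first by rewrite cats0.
by rewrite cat_path sw /= sv andbT; apply: wv => //; apply: mem_last.
Qed.

Variables (G : Grp) (I : Type) (Gi : I -> Grp) (iota : forall i, Gi i -> G).
Arguments iota : clear implicits.
Variables (rho : G -> cbijGrp) (rho_hom : is_hom rho).
Variables (cl : J -> nat) (e : I -> nat) (e_inj : injective e).

Definition spelled (u : G) (w : seq letter) : Prop :=
  reduced w /\ forall x q, cfw (rho u) x q = run x w q.

Hypothesis syllables : forall i x, x <> gone (Gi i) ->
  exists w, [/\ spelled (iota i x) w, w <> [::] & all (fun l : letter => cl (tag l) == e i) w].

(** A new syllable on the right acts first, so its word is put in front. The junction stays reduced
    because, [e] being injective, the letters on its two sides differ under [cl]. *)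
Lemma normal_spelled c u : normal_form iota c u -> exists w, spelled u w /\
  match c with
  | Some i => exists l w', w = l :: w' /\ cl (tag l) = e i
  | None => w = [::] /\ u = gone G
  end.
Proof.
elim=> [|{c}{}u c i x _ [w [[rw we] wc]] ci x1].
  by exists [::]; do !split; rewrite // (hom_one rho_hom).
have [v [[rv ve] v0 vi]] := syllables x1.
exists (v ++ w); split; last first.
  by case: v v0 vi {rv ve} => // l v _ /= /andP[/eqP li _]; exists l, (v ++ w).
split=> [|y q]; last by rewrite rho_hom run_cat /= we ve.
apply: reduced_cat => // l l' w' lv ew.
case: c wc ci => [i'|[e0]] //; last by rewrite e0 in ew.
move=> [l2 [w2 [e2 li']]] ci; rewrite ew in e2; case: e2 => ? ?; subst l2 w2.
apply/eqP => ll; apply: ci; congr Some; apply: e_inj.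
by rewrite -li' -ll; apply/eqP/(allP vi).
Qed.

End CellGroup.

(** * Realising finite and infinite cyclic factors *)

Lemma finite_grp_perm (G : Grp) : finite_grp G ->
  exists m (theta : G -> {perm 'I_m}),
    (forall x y, theta (gmul x y) = (theta x * theta y)%g) /\ injective theta.
Proof.
case=> s hs; pose T : choiceType := {classic G}; pose s' : seq T := s.
have s'T (x : T) : x \in s'.
  rewrite /s' {s'}; move: (hs x) => {hs}; elim: s => //= y s IH [->|/IH xs]; first exact: mem_head.
  by rewrite inE xs orbT.
pose p (x : G) : 'I_#|{: seq_sub s'}| := enum_rank (SeqSub (s'T x)).
pose v (i : 'I_#|{: seq_sub s'}|) : G := ssval (enum_val i).
have pK : cancel p v by move=> x; rewrite /v /p enum_rankK.
have vK : cancel v p.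
  by move=> i; apply: enum_val_inj; apply: val_inj; rewrite /p enum_rankK.
(* Right translations are used since permutations compose from left to right. *)
have r_inj x : injective (fun i => p (gmul (v i) x)).
  by move=> i j /(can_inj pK) e; apply: (can_inj vK); rewrite -(gmulrK x (v i)) e gmulrK.
exists _, (fun x => perm (r_inj x)); split=> [x y|x y e].
  by apply/permP => i; rewrite permM !permE pK gmulA.
have := congr1 (fun t : {perm _} => t (p (gone G))) e.
by rewrite !permE => /(can_inj pK); rewrite pK !gmul1.
Qed.

Section Factors.
Variables (Sigma : finType) (a0 a1 : Sigma) (n : nat).
Hypotheses (a01 : a0 != a1) (n_ge5 : (4 < n)%N).

(* The finite groups acting on blocks: infinitely many copies of each symmetric group. *)
Definition sym (j : nat * nat) : finGroupType := {perm 'I_j.2}.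
Local Notation letter := (@letter (nat * nat)%type sym).
Local Notation run := (@run Sigma a0 a1 n (nat * nat)%type sym).
Local Notation cbijGrp := (cbijGrp a0 a1 n).
Local Notation cmove j u := (@cbij_move Sigma a0 a1 n a01 n_ge5 (nat * nat)%type sym j u).

(** The factor numbered [k] owns the copies [2k] and [2k+1] of each symmetric group, so different
    factors share no letter; an infinite cyclic factor takes one involution from each. *)
Definition factor_words (k : nat) (X : Grp) (r : X -> cbijGrp) : Prop :=
  forall x, x <> gone X -> exists w : seq letter,
    [/\ reduced w /\ (forall y q, cfw (r x) y q = run y w q), w <> [::]
      & all (fun l : letter => (tag l).1./2 == k) w].

Lemma finite_factor k X : finite_grp X ->
  exists r : X -> cbijGrp, is_hom r /\ factor_words k r.
Proof.
case/finite_grp_perm => m [theta [thetaM theta_inj]].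
exists (fun x => cmove (k.*2, m) (theta x)); split.
  by move=> x y; rewrite thetaM cbij_moveM.
have theta1 : theta (gone X) = 1%g.
  by apply: (mulgI (theta (gone X))); rewrite -thetaM gmul1 mulg1.
move=> x x1; exists [:: @ltr _ sym (k.*2, m) (theta x)]; split=> //=; last first.
  by rewrite doubleK eqxx.
rewrite /reduced /= !andbT; split=> //; apply/eqP => e; apply: x1.
by apply: theta_inj; rewrite theta1.
Qed.

Lemma alternating_reduced (l l' : letter) k : tagged l != 1%g -> tagged l' != 1%g ->
  tag l != tag l' -> reduced (flatten (nseq k [:: l; l'])).
Proof.
move=> l1 l'1 ll; have l'l : tag l' != tag l by rewrite eq_sym.
apply/andP; split; first by elim: k => //= k ->; rewrite l1 l'1.
by case: k => //= k; rewrite ll /=; elim: k => //= k IH; rewrite l'l ll.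
Qed.

Lemma Z_factor k X : iso_to_Z X ->
  exists r : X -> cbijGrp, is_hom r /\ factor_words k r.
Proof.
case=> phi [phiD [phi_inj phi_surj]].
have [psi psiK] := choice phi_surj.
have psiD x y : psi (gmul x y) = psi x + psi y.
  by apply: phi_inj; rewrite phiD !psiK.
pose t : {perm 'I_2} := tperm ord0 ord_max.
have t1 : t != 1%g by apply/eqP => /permP/(_ ord0); rewrite tpermL perm1.
pose la : letter := @ltr _ sym (k.*2, 2) t; pose lb : letter := @ltr _ sym (k.*2.+1, 2) t.
pose ab : cbijGrp := cbij_mul (cmove (k.*2, 2) t) (cmove (k.*2.+1, 2) t).
(* In [ab] the involution of the odd copy acts first, hence [lb] before [la] for positive powers and
   the reverse for negative ones. *)
have ab_pos m y q : cfw (gpow ab (Posz m)) y q = run y (flatten (nseq m [:: lb; la])) q.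
  by elim: m q => //= m IH q; rewrite IH.
have ab_neg m y q : cfw (gpow ab (Negz m)) y q = run y (flatten (nseq m.+1 [:: la; lb])) q.
  have S u z p : cfw (gmul u (ginv ab)) z p = cfw u z (run z [:: la; lb] p).
    by rewrite /= /t !tpermV.
  rewrite /gpow; elim: {m}m.+1 q => // m IH q.
  by rewrite iterS S IH -run_cat.
exists (fun x => gpow ab (psi x)); split=> [x y|x x1]; first by rewrite psiD gpowD.
have cls l l' m : (tag l).1./2 = k -> (tag l').1./2 = k ->
    all (fun l : letter => (tag l).1./2 == k) (flatten (nseq m [:: l; l'])).
  by move=> lk l'k; elim: m => //= m ->; rewrite lk l'k eqxx.
have kab : ((k.*2, 2%N) == (k.*2.+1, 2%N)) = false by apply/eqP => -[]; lia.
have ka : (k.*2)./2 = k by rewrite doubleK.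
have kb : (k.*2.+1)./2 = k by rewrite -uphalfE uphalf_double.
case ex : (psi x) => [[|m]|m].
- have phi0 : phi 0 = gone X by apply: (@gmulI _ (phi 0)); rewrite -phiD gmulr1 addr0.
  by case: x1; rewrite -phi0 -(psiK x) ex.
- exists (flatten (nseq m.+1 [:: lb; la])); split=> //; last exact: cls.
  by split; [apply: alternating_reduced; rewrite //= eq_sym kab|apply: ab_pos].
- exists (flatten (nseq m.+1 [:: la; lb])); split=> //; last exact: cls.
  by split; [apply: alternating_reduced; rewrite //= kab|apply: ab_neg].
Qed.

End Factors.

Section SpelledFreeProduct.
Variables (Sigma : finType) (a0 a1 : Sigma) (n : nat).
Hypotheses (a01 : a0 != a1) (n_ge5 : (4 < n)%N).

Lemma free_product_spelled (G : Grp) (I : Type) (Gi : I -> Grp) :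
  countable_index I -> (forall i, finite_grp (Gi i) \/ iso_to_Z (Gi i)) ->
  is_free_product G Gi ->
  exists rho : G -> cbijGrp a0 a1 n, is_hom rho /\
    forall u, exists w : seq (letter sym), spelled rho u w /\ (w = [::] -> u = gone G).
Proof.
case=> e e_inj Gi_cases [iota [iota_hom univ]].
have fac i : exists r : Gi i -> cbijGrp a0 a1 n, is_hom r /\ factor_words (e i) r.
  by case: (Gi_cases i) => h; [apply: finite_factor|apply: Z_factor].
pose r i := projT1 (cid (fac i)).
have r_hom i : is_hom (r i) by apply: (proj1 (projT2 (cid (fac i)))).
have r_words i : factor_words (e i) (r i) by apply: (proj2 (projT2 (cid (fac i)))).
have [rho [[rho_hom rhoE] _]] := univ _ r r_hom.
exists rho; split=> // u.
have syl i x : x <> gone (Gi i) -> exists w : seq (letter sym),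
    [/\ spelled rho (iota i x) w, w <> [::]
      & all (fun l : letter sym => (tag l).1./2 == e i) w].
  move=> /(r_words i x) [w [[rw we] w0 wi]]; exists w; split=> //; split=> //.
  by rewrite rhoE.
have [c nu] := free_product_normal iota_hom univ u.
have [w [sw wc]] := normal_spelled rho_hom (cl := fun j => j.1./2) e_inj syl nu.
exists w; split=> // w0; case: c wc {nu} => [i [l [w' [e' _]]]|[]//].
by rewrite w0 in e'.
Qed.

End SpelledFreeProduct.

(** * Lamps *)

Section FiniteSupport.
Variables (A : zmodType) (G : Type).
Implicit Types f : G -> A.
Local Notation cG := {classic G}.

(** A sum over all of [G], rather than over a chosen list, can be reindexed by translations. *)
Definition fsum f : A := \sum_(z \in [set: cG]) f z.

Lemma fsumE f (s : seq cG) : uniq s -> (forall z : cG, z \notin s -> f z = 0) ->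
  fsum f = \sum_(z <- s) f z.
Proof.
move=> us fs; rewrite /fsum (fsbigE s) // => [|z _]; last exact: fs.
by apply: eq_bigl => z; rewrite in_setT.
Qed.

Lemma finsuppP f : finsupp f -> exists s : seq cG, uniq s /\ forall z : cG, z \notin s -> f z = 0.
Proof.
case=> s hs; exists (undup (s : seq cG)); rewrite undup_uniq; split=> // z.
rewrite mem_undup; apply: contraNeq => /hs {hs}; elim: s => //= y s IH [->|/IH zs].
  exact: mem_head.
by rewrite inE zs orbT.
Qed.

Lemma finsupp2 f f' : finsupp f -> finsupp f' ->
  exists s : seq cG, uniq s /\ forall z : cG, z \notin s -> f z = 0 /\ f' z = 0.
Proof.
case/finsuppP => s [_ hs] /finsuppP[s' [_ hs']]; exists (undup (s ++ s')).
rewrite undup_uniq; split=> // z; rewrite mem_undup mem_cat negb_or.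
by case/andP => /hs ? /hs' ?.
Qed.

End FiniteSupport.

Section Lamps.
Variables (Sigma : finType) (a0 a1 : Sigma) (A : finZmodType).
Hypothesis a01 : a0 != a1.
(** At least five places for the pattern, and at least [#|A|] for the copy of [A]. *)
Let n := #|A|.+4.+1.
Let n_ge5 : (4 < n)%N. Proof. by []. Qed.
Local Notation tape := (int -> Sigma).
Local Notation mk := (@mk Sigma a0 a1 n).
Local Notation gap := (@gap Sigma a0 a1 n).
Variables (G : Grp) (rho : G -> cbijGrp a0 a1 n) (rho_hom : is_hom rho).
Implicit Types (f : G -> A) (g : G) (x : tape).

(* The first [#|A|] positions of a cell are indexed by [A], which acts on them by translation. *)
Definition tau (b : A) (r : nat) : nat :=
  if insub r is Some i then enum_rank (enum_val (i : 'I_#|A|) + b) else r.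

Lemma tauD b c r : tau (b + c) r = tau b (tau c r).
Proof.
rewrite /tau; case: insubP => [i ri ei|/negPf ri]; last by rewrite insubF.
by rewrite valK enum_rankK addrA addrAC.
Qed.

Lemma tau0 r : tau 0 r = r.
Proof. by rewrite /tau; case: insubP => [i ri ei|//]; rewrite addr0 enum_valK. Qed.

Let card_le_n : (#|A| <= n)%N. Proof. by do 5 apply: leqW. Qed.

Lemma tau_lt b r : (r < n)%N -> (tau b r < n)%N.
Proof.
rewrite /tau; case: insubP => // i _ _ _.
by apply: leq_trans (ltn_ord _) card_le_n.
Qed.

Lemma tau_inj b c : tau b (enum_rank (0 : A)) = tau c (enum_rank (0 : A)) -> b = c.
Proof. by rewrite /tau valK enum_rankK !add0r => /val_inj/enum_rank_inj. Qed.

Definition lamp x (p : int) : bool := gap x p 0.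

Lemma actM g g' x p : cfw (rho (gmul g g')) x p = cfw (rho g) x (cfw (rho g') x p).
Proof. by rewrite rho_hom. Qed.

Lemma act1 x p : cfw (rho (gone G)) x p = p.
Proof. by rewrite (hom_one rho_hom). Qed.

(** The conjugate by [z] of the lamp action of [f z] translates the cell [p] when the inverse of [z]
    brings it to a lamp. These translations stay in the cell and commute, so they add up. *)
Definition lamps f x (p : int) : A :=
  fsum (fun z => if lamp x (cfw (rho (ginv z)) x p) then f z else 0).

Lemma lampsE f x p (s : seq {classic G}) : uniq s ->
  (forall z : {classic G}, z \notin s -> f z = 0) ->
  lamps f x p = \sum_(z <- s) if lamp x (cfw (rho (ginv z)) x p) then f z else 0.
Proof. by move=> us fs; apply: fsumE => // z /fs ->; rewrite if_same. Qed.

Lemma lampsD f f' x p : finsupp f -> finsupp f' ->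
  lamps (fun z => f z + f' z) x p = lamps f x p + lamps f' x p.
Proof.
move=> hf hf'; have [s [us hs]] := finsupp2 hf hf'.
rewrite !(@lampsE _ x p s) //; try by move=> z /hs[e e'] //; rewrite e e' addr0.
by rewrite -big_split; apply: eq_bigr => z _; case: ifP => //= _; rewrite addr0.
Qed.

Lemma lamps_translate f g x p :
  lamps (fun z => f (gmul (ginv g) z)) x (cfw (rho g) x p) = lamps f x p.
Proof.
pose h (z : {classic G}) : {classic G} := gmul g z.
have hb : bijective h.
  by exists (fun z => gmul (ginv g) z) => z; rewrite /h ?gmulKl // gmulA gmulrV gmul1.
rewrite /lamps /fsum (reindex_fsbigT h) //; apply: eq_fsbigr => z _.
by rewrite /h gmulKl ginvM actM -[cfw (rho (ginv g)) x _]actM gmulV act1.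
Qed.

Lemma lamps_shift f m x p : lamps f (shift m x) p = lamps f x (p + m).
Proof.
congr fsum; apply: funext => z; rewrite /lamp gap_shift.
by rewrite (cellular_shift (cfw_cellular _)).
Qed.

Lemma lc_lamps f p : finsupp f -> lc (fun x => lamps f x p).
Proof.
case/finsuppP => s [us hs].
pose F (z : {classic G}) x := if lamp x (cfw (rho (ginv z)) x p) then f z else 0.
have -> : lamps f ^~ p = fun x => \sum_(z <- s) F z x.
  by apply/funext => x; apply: lampsE us hs.
apply: lc_sum => z; apply: (lc_map (fun b : bool => if b then f z else 0)).
apply: (lc_bind (g := fun q x => lamp x q)); first exact: (cellular_lc (cfw_cellular _)).
by move=> q; apply: lc_gap.
Qed.

Definition cell x (p : int) : bool := mk x true p || mk x false p.

Lemma mk_cell x b p : mk x b p -> cell x p.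
Proof. by rewrite /cell; case: b => ->; rewrite ?orbT. Qed.

Lemma cellP x p : cell x p -> exists b, mk x b p.
Proof. by case/orP => h; [exists true|exists false]. Qed.

Lemma cell_act g x p : cell x p -> cell x (cfw (rho g) x p).
Proof. by case/cellP => b /(cellular_mk (cfw_cellular (rho g)))[b' /mk_cell]. Qed.

Lemma cell_uniq x p p' (r r' : nat) : cell x p -> cell x p' -> (r < n)%N -> (r' < n)%N ->
  p + r%:Z = p' + r'%:Z -> p = p' /\ r = r'.
Proof.
wlog rr : p p' r r' / (r' <= r)%N.
  move=> W h h' l l' e; case/orP: (leq_total r' r) => rr; first exact: W.
  by have [-> ->] := W _ _ _ _ rr h' h l' l (esym e).
move=> /cellP[b hb] /cellP[b' hb'] rn _ e.
have ep : p' = p + (r - r')%N%:Z by lia.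
rewrite ep in hb'; have [|r0 _] := mk_nonoverlap a01 n_ge5 _ hb hb'; first by lia.
by split; lia.
Qed.

Definition offset x q : option 'I_n := [pick r : 'I_n | cell x (q - r%:Z)].

Lemma offset_cell x p (r : 'I_n) : cell x p -> offset x (p + r%:Z) = Some r.
Proof.
move=> h; rewrite /offset; case: pickP => [r' h'|/(_ r)]; last by rewrite addrK h.
have [|_ e] := cell_uniq h h' (ltn_ord r) (ltn_ord r'); first by rewrite subrK.
by congr Some; apply: val_inj.
Qed.

(** This follows [(f, g) = (f, 1) (1, g)]: the cell moves with the offset kept, then the offset is
    translated by the lamp value of the new cell. *)
Definition lift_act f g x q : int :=
  if offset x q is Some r then
    cfw (rho g) x (q - (r : nat)%:Z) + (tau (lamps f x (cfw (rho g) x (q - (r : nat)%:Z))) r)%:Z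
  else q.

Lemma lift_act_cell f g x p r : cell x p -> (r < n)%N ->
  lift_act f g x (p + r%:Z) = cfw (rho g) x p + (tau (lamps f x (cfw (rho g) x p)) r)%:Z.
Proof.
by move=> h rn; rewrite /lift_act (@offset_cell x p (Ordinal rn)) //= addrK.
Qed.

Variant offset_spec x : int -> Prop :=
| OffsetCell p (r : nat) of cell x p & (r < n)%N : offset_spec x (p + r%:Z)
| OffsetNone q of offset x q = None : offset_spec x q.

Lemma offsetP x q : offset_spec x q.
Proof.
case e : (offset x q) => [r|]; last exact: OffsetNone.
rewrite -[q](subrK (r : nat)%:Z); apply: OffsetCell => //.
by move: e; rewrite /offset; case: pickP => // r' h [<-].
Qed.

(** By [lamps_translate] the translate of [f'] has after [g g'] the lamp value that [f'] has after
    [g']; [tauD] composes it with that of [f]. *)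
Lemma lift_actM f g f' g' x q : finsupp f -> finsupp f' ->
  lift_act (wr_fun f g f') (gmul g g') x q = lift_act f g x (lift_act f' g' x q).
Proof.
move=> hf hf'; case: (offsetP x q) => [p r h rn|{}q e]; last by rewrite /lift_act !e.
rewrite !lift_act_cell ?cell_act ?tau_lt // rho_hom /=; congr (_ + Posz _).
rewrite -tauD; congr tau; rewrite lampsD //; last first.
  case: hf' => s hs; exists (List.map (gmul g) s) => z /hs zs.
  by rewrite -[z]gmul1 -(gmulrV g) -gmulA; apply: List.in_map.
by rewrite lamps_translate.
Qed.

Lemma lift_act1 x q : lift_act (fun=> 0) (gone G) x q = q.
Proof.
case: (offsetP x q) => [p r h rn|{}q e]; last by rewrite /lift_act !e.
rewrite lift_act_cell // (hom_one rho_hom) /=.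
by rewrite (@lampsE _ x p [::]) // big_nil tau0.
Qed.

Lemma lift_act_shift f g m x q : lift_act f g (shift m x) q + m = lift_act f g x (q + m).
Proof.
have cs p : cell (shift m x) p = cell x (p + m) by rewrite /cell !mk_shift.
have e : offset (shift m x) q = offset x (q + m).
  by apply: eq_pick => r; rewrite cs addrAC.
rewrite /lift_act e; case: offset => // r.
rewrite addrAC lamps_shift !(cellular_shift (cfw_cellular _)).
by rewrite -[q + m - _]addrAC.
Qed.

Lemma lc_lift_act f g q : finsupp f -> lc (fun x => lift_act f g x q).
Proof.
move=> hf.
apply: (lc_bind (f := fun x => offset x q) (g := fun o x => if o is Some r then
    cfw (rho g) x (q - (r : nat)%:Z) + (tau (lamps f x (cfw (rho g) x (q - (r : nat)%:Z))) r)%:Z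
  else q)).
  by apply: lc_pick => r; apply: (lc_map2 orb); apply: lc_mk.
case=> [r|]; last exact: lc_const.
apply: (lc_bind (f := fun x => cfw (rho g) x (q - (r : nat)%:Z))
  (g := fun p x => p + (tau (lamps f x p) r)%:Z)).
  exact: (cellular_lc (cfw_cellular _)).
by move=> p; apply: (lc_map (fun b => p + (tau b r)%:Z)); apply: lc_lamps.
Qed.

(** Moving a head that stands at 0 amounts to shifting the tape under it; its displacement is the
    cocycle. *)
Definition embed f g x : tape := shift (lift_act f g x 0) x.

Lemma shiftD (m k : int) x : shift m (shift k x) = shift (m + k) x.
Proof. by apply/funext => i; rewrite /shift addrA. Qed.

Lemma embedM f g f' g' x : finsupp f -> finsupp f' ->
  embed (wr_fun f g f') (gmul g g') x = embed f g (embed f' g' x).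
Proof.
by move=> hf hf'; rewrite /embed shiftD lift_act_shift add0r lift_actM.
Qed.

Lemma cont_embed f g : finsupp f -> cont_map (embed f g).
Proof.
move=> hf x M; have [N hN] := lc_lift_act g 0 hf x.
exists (maxn N (M + `|lift_act f g x 0|)) => y h.
rewrite /embed hN; last by apply: agree_le h; lia.
by apply: agree_shift; apply: agree_le h; lia.
Qed.

(** The first coordinate of the inverse of [(f, g)] in the wreath product. *)
Definition wr_inv f g : G -> A := fun z => - f (gmul g z).

Lemma finsupp_inv f g : finsupp f -> finsupp (wr_inv f g).
Proof.
case=> s hs; exists (List.map (gmul (ginv g)) s) => z; rewrite oppr_eq0 => /hs zs.
by rewrite -[z](gmulKl g); apply: List.in_map.
Qed.

Lemma embed1 x : embed (fun=> 0) (gone G) x = x.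
Proof. by rewrite /embed lift_act1; apply/funext => i; rewrite /shift addr0. Qed.

Lemma embed_full_group f g : finsupp f -> in_full_group (embed f g).
Proof.
move=> hf; have hf' := finsupp_inv g hf; split; last first.
  exists (fun x => lift_act f g x 0); split=> // x; exact: lc_lift_act.
split; first exact: cont_embed.
exists (embed (wr_inv f g) (ginv g)); split; first exact: cont_embed.
split=> x; rewrite -embedM //.
  rewrite gmulV (_ : wr_fun _ _ _ = fun=> 0) ?embed1 //.
  by apply/funext => z; rewrite /wr_fun /wr_inv ginvK addNr.
rewrite gmulrV (_ : wr_fun _ _ _ = fun=> 0) ?embed1 //.
by apply/funext => z; rewrite /wr_fun /wr_inv gmulA gmulrV gmul1 addrN.
Qed.

(** * Faithfulness of the wreath product action *)

Variables (J : countType) (K : J -> finGroupType).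
Local Notation letter := (@letter J K).
Hypothesis words : forall u, exists w : seq letter, spelled rho u w /\ (w = [::] -> u = gone G).

Lemma cell_spells x (w : seq letter) : spells a0 a1 n x 0 w -> cell x 0.
Proof.
by case: w => [|l w] /=; [move=> h|case/andP=> h _]; apply: (@mk_cell _ true); case/and3P: h.
Qed.

(** On an aperiodic tape equal images mean equal displacements; starting points other than 0 are
    reached by shifting the tape. *)
Lemma lift_act_eq f g f' g' x : (forall y, embed f g y = embed f' g' y) ->
  injective (fun m => shift m x) -> forall q, lift_act f g x q = lift_act f' g' x q.
Proof.
move=> fg inj q; apply: inj; have := fg (shift q x).
by rewrite /embed !shiftD !lift_act_shift add0r.
Qed.

(** On a tape spelling the word of [g^-1 g'], both elements send the cell at 0 to the same cell, so
    [g^-1 g'] fixes 0. But its word moves 0 by its length, hence is empty. *)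
Lemma embed_inj_grp f g f' g' : (forall x, embed f g x = embed f' g' x) -> g = g'.
Proof.
move=> fg; have [w [[rw we] w0]] := words (gmul (ginv g) g').
have [x [hw x_ge0 inj]] := spelling_tape a01 n_ge5 w.
have c0 := cell_spells hw.
have := lift_act_eq fg inj (0 + 0%:Z); rewrite !lift_act_cell // => h.
have lt b : (tau b 0 < n)%N by apply: tau_lt.
have [e _] := cell_uniq (cell_act g c0) (cell_act g' c0) (lt _) (lt _) h.
have := run_spells a01 n_ge5 rw hw; rewrite -we actM -e -actM gmulV act1 add0r => l0.
apply: (@gmulI _ (ginv g)); rewrite gmulV [RHS]w0 //.
by case: (w) l0 => // l v []; rewrite len_cons; lia.
Qed.

(* Among the inverses of the elements of the support choose one whose word is
   longest: on its tape only that element sees the lamp from position 0. *)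
Lemma lamps_neq0 f z : finsupp f -> f z != 0 ->
  exists x, [/\ cell x 0, injective (fun m => shift m x) & lamps f x 0 != 0].
Proof.
move=> hf fz; have [s [us hs]] := finsuppP hf.
have [word wordP] := choice words.
pose L (z : {classic G}) := size (word (ginv z)).
have zs : (z : {classic G}) \in s by apply: contraNT fz => /hs ->.
have [y [ys fy ymax]] : exists y : {classic G}, [/\ y \in s, f y != 0 &
    forall v : {classic G}, v \in s -> f v != 0 -> (L v <= L y)%N].
  have ex : exists k, has (fun v : {classic G} => (f v != 0) && (L v == k)) s.
    by exists (L z); apply/hasP; exists z => //; rewrite fz eqxx.
  have bd k : has (fun v : {classic G} => (f v != 0) && (L v == k)) s -> (k <= \max_(v <- s) L v)%N.
    by case/hasP => v vs /andP[_ /eqP <-]; apply: (leq_bigmax_seq (P := xpredT)).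
  case: (ex_maxnP ex bd) => k /hasP[y ys /andP[fy /eqP Ly]] kmax.
  exists y; split=> // v vs fv; rewrite Ly; apply: kmax.
  by apply/hasP; exists v => //; rewrite fv eqxx.
have [[rw we] _] := wordP (ginv y).
have [x [hw x_ge0 inj]] := spelling_tape a01 n_ge5 (word (ginv y)).
exists x; split=> //; first exact: cell_spells hw.
rewrite (lampsE x 0 us hs) (bigD1_seq y) //= we (run_spells a01 n_ge5 rw hw).
have -> : lamp x (0 + (len n (word (ginv y)))%:Z).
  elim: (word (ginv y)) {rw we} (0 : int) hw => [|l v IH] s0 /=; first by rewrite /len muln0 addr0.
  by case/andP => _ /IH; rewrite len_cons PoszD addrA.
(* Any other nonzero term would see a lamp on the spelled part, which is the final one, so its word
   would be that of [ginv y]. *)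
rewrite big1_seq ?addr0 // => v /andP[vy vs]; case: ifP => // hl.
apply/eqP; apply: contraNT vy => fv; apply/eqP.
have [[rv ve] _] := wordP (ginv v); have Lv := ymax v vs fv.
have hw' := hw; rewrite -(cat_take_drop (L v) (word (ginv y))) in hw'.
have sz : size (word (ginv v)) = size (take (L v) (word (ginv y))) by rewrite size_takel.
have [r0 rl _] := run_range a01 n_ge5 x_ge0 hw' sz.
have rl' : run a0 a1 n x (word (ginv v)) 0 <= 0 + (len n (word (ginv y)))%:Z.
  rewrite add0r; apply: le_trans rl _; rewrite -{2}(cat_take_drop (L v) (word (ginv y))).
  by rewrite /len map_cat sumn_cat; nia.
rewrite ve in hl; have := spells_lamp a01 n_ge5 hw r0 rl' hl; rewrite add0r => er.
have eww := run_unique a01 n_ge5 x_ge0 hw Lv er.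
have rvy : rho (ginv v) = rho (ginv y).
  by apply: cbij_inj => x' q; rewrite ve we eww.
(* The two inverses act alike, so [v y^-1] fixes the start of a tape spelling its own word, which is
   therefore empty. *)
have e1 : gmul v (ginv y) = gone G.
  have [u [[ru ue] u0]] := words (gmul v (ginv y)); apply: u0.
  have [x' [hu _ _]] := spelling_tape a01 n_ge5 u.
  have := run_spells a01 n_ge5 ru hu.
  rewrite -ue actM -rvy -actM gmulrV act1 add0r => l0.
  by case: (u) l0 => // l v' []; rewrite len_cons; lia.
by rewrite (ginv_uniq e1) ginvK.
Qed.

Lemma embed_inj f g f' g' : finsupp f -> finsupp f' ->
  (forall x, embed f g x = embed f' g' x) -> (forall y, f y = f' y) /\ g = g'.
Proof.
move=> hf hf' fg; have gg := embed_inj_grp fg; subst g'; split=> // z.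
apply/eqP; rewrite -subr_eq0; apply/negPn/negP => dz.
have hN : finsupp (fun z => - f' z).
  by case: hf' => s hs; exists s => y; rewrite oppr_eq0; apply: hs.
have hd : finsupp (fun z => f z + - f' z).
  have [s [_ hs]] := finsupp2 hf hN.
  exists s => y; have [ys _|/hs[-> ->]] := boolP ((y : {classic G}) \in s); last first.
    by rewrite addr0 eqxx.
  elim: s ys {hs} => //= v s IH; rewrite inE => /predU1P[->|/IH]; [by left|by right].
have [x [c0 inj /eqP[]]] := lamps_neq0 hd dz.
(* The starting cell is the one that [g] brings to 0; from the offset of [0 : A], [tau_inj] recovers
   the lamp value. *)
have := lift_act_eq fg inj (cfw (rho (ginv g)) x 0 + (enum_rank (0 : A))%:Z).
have rn : (enum_rank (0%R : A) < n)%N.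
  by apply: leq_trans (ltn_ord _) card_le_n.
rewrite !lift_act_cell ?cell_act //.
rewrite -!actM gmulrV act1 !add0r => -[/tau_inj e].
by rewrite lampsD // e -lampsD // (@lampsE _ x 0 [::]) ?big_nil // => y _; rewrite addrN.
Qed.

End Lamps.

Theorem mainTheorem14 :
  (forall (G : Grp) (I : Type) (Gi : I -> Grp),
     countable_index I ->
     (forall i, finite_grp (Gi i) \/ iso_to_Z (Gi i)) ->
     is_free_product G Gi ->
     forall (A : finZmodType) (Sigma : finType), (1 < #|Sigma|)%N ->
       wreath_embeds A G Sigma) /\
  (forall Sigma : finType, (1 < #|Sigma|)%N -> wreath_embeds 'Z_2 intGrp Sigma).
Proof.
have main (G : Grp) (I : Type) (Gi : I -> Grp) : countable_index I ->
    (forall i, finite_grp (Gi i) \/ iso_to_Z (Gi i)) -> is_free_product G Gi ->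
    forall (A : finZmodType) (Sigma : finType), (1 < #|Sigma|)%N -> wreath_embeds A G Sigma.
  move=> hI hGi hG A Sigma /card_gt1P[a0 [a1 [_ _ a01]]].
  have n5 : (4 < #|A|.+4.+1)%N by [].
  have [rho [rho_hom words]] := free_product_spelled a01 n5 hI hGi hG.
  exists (embed rho); split; [|split].
  - by move=> f g; apply: embed_full_group.
  - by move=> f g f' g'; apply: embed_inj words f g f' g'.
  - by move=> f g f' g' hf hf' x; apply: embedM.
(* The group [intGrp] is the free product of a single factor, itself. *)
split=> // Sigma; apply: (main intGrp unit (fun=> intGrp)).
- by exists (fun=> 0%N) => -[] [].
- by move=> _; right; exists id; split=> //; split=> // x; exists x.
- exists (fun _ x => x); split=> // H fi fiM; exists (fi tt); split=> [|f' _ e y]; last exact: e.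
  by split=> // -[].
Qed.
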